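(* Let $n\in\mathbb{N}$, let $O_n$ be the directed graph with one vertex $v_O$ and $n$ loop edges, with graph groupoid $\mathbb{O}_n$ and graph von Neumann algebra $M_{O_n}$, and let $T=\sum_{w\in\mathrm{Supp}(T)}t_wL_w\in M_{O_n}$ be a graph operator. Then $T$ is unitary if and only if both of the following hold: (i) $\{w_1^{-1}w_2: w_1,w_2\in\mathrm{Supp}(T)\}=\{v_O\}$; (ii) $\displaystyle\sum_{(w_1,w_2)\in \mathrm{Supp}(T)\times\mathrm{Supp}(T)}\overline{t_{w_1}}\,t_{w_2}=1$.
   Context: The graph $O_n$ has vertex set $\{v_O\}$ and loop edges $e_1,\dots,e_n$. Each edge $e$ has a formal shadow (inverse) edge $e^{-1}$, also a loop at $v_O$. The graph groupoid $\mathbb{O}_n$ consists of $v_O$ and all reduced finite words in $e_1^{\pm1},\dots,e_n^{\pm1}$, with product given by concatenation followed by the reduction $ww^{-1}=w^{-1}w=v_O$; $v_O$ acts as identity, so $\mathbb{O}_n$ is a group (free on $e_1,\dots,e_n$). $H_{O_n}=l^2(\mathbb{O}_n)$ has orthonormal basis $\{\xi_w:w\in\mathbb{O}_n\}$, and $L_w\in B(H_{O_n})$ is given by $L_w\xi_{w'}=\xi_{ww'}$. The graph von Neumann algebra $M_{O_n}$ is the weak-operator closure of the linear span of $\{L_w:w\in\mathbb{O}_n\}$; its identity is $L_{v_O}$. Each $T\in M_{O_n}$ has an expansion $T=\sum_{w\in\mathbb{O}_n}t_wL_w$, $t_w\in\mathbb{C}$; its support is $\mathrm{Supp}(T)=\{w\in\mathbb{O}_n:t_w\neq0\}$,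 and $T$ is a graph operator if $\mathrm{Supp}(T)$ is finite. *)

(* Defs.v *)
From HB Require Import structures.
From mathcomp Require Import all_boot all_order all_algebra.
From mathcomp Require Import complex ring lra.
From mathcomp Require Import all_classical all_reals all_analysis.

Set Implicit Arguments.
Unset Strict Implicit.
Unset Printing Implicit Defensive.

Import Order.TTheory GRing.Theory Num.Theory.
Import ComplexField.Normc.

Local Open Scope classical_set_scope.
Local Open Scope ring_scope.

Section Groupoid.
Variable n : nat.

(* [(i, true)] is the i-th loop edge of O_n, [(i, false)] is its shadow. *)
Definition letter : Type := ('I_n * bool)%type.
HB.instance Definition _ := Countable.on letter.

Definition shadow (a : letter) : letter := (a.1, ~~ a.2).

Lemma shadowK : involutive shadow.
Proof. by move=> [i b]; rewrite /shadow /= negbK. Qed.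

Definition reduced : seq letter -> bool := sorted (fun a b => b != shadow a).

(* All edges are loops at v_O, so any two letters are composable; v_O is the
   empty word. *)
Definition groupoid : Type := {s : seq letter | reduced s}.
HB.instance Definition _ := Countable.on groupoid.

Definition push (a : letter) (s : seq letter) : seq letter :=
  if s is b :: s' then if b == shadow a then s' else a :: s else [:: a].

(* The reduced word obtained from [s] by cancelling all factors
   [a (shadow a)]. *)
Definition reduce (s : seq letter) : seq letter := foldr push [::] s.

Lemma push_reduced a s : reduced s -> reduced (push a s).
Proof.
case: s => // b s rbs /=; case: eqP => [_|/eqP nba]; first exact: path_sorted rbs.
by rewrite /= nba.
Qed.

Lemma foldr_push_reduced s t : reduced t -> reduced (foldr push t s).
Proof. by move=> rt; elim: s => //= a s; exact: push_reduced. Qed.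

Lemma reduce_reduced s : reduced (reduce s).
Proof. exact: foldr_push_reduced. Qed.

Lemma push_id a s : reduced (a :: s) -> push a s = a :: s.
Proof. by case: s => //= b s /andP[/negPf->]. Qed.

Lemma pushK a s : reduced s -> push a (push (shadow a) s) = s.
Proof.
case: s => [|b s] rs /=; first by rewrite eqxx.
rewrite shadowK; case: eqP => [<-|_] /=; last by rewrite eqxx.
exact: push_id.
Qed.

Lemma reduce_id s : reduced s -> reduce s = s.
Proof.
elim: s => //= a s IHs ras; rewrite IHs ?push_id//; exact: path_sorted ras.
Qed.

Lemma reduce_cat s t : reduce (s ++ t) = foldr push (reduce t) s.
Proof. exact: foldr_cat. Qed.

Lemma foldr_push a s t : reduced t ->
  foldr push t (push a s) = push a (foldr push t s).
Proof.
case: s => //= b s rt; case: eqP => [->|//].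
by rewrite pushK// foldr_push_reduced.
Qed.

Lemma foldr_reduce s t : reduced t -> foldr push t (reduce s) = foldr push t s.
Proof. by move=> rt; elim: s => //= a s <-; exact: foldr_push. Qed.

Definition invw (s : seq letter) : seq letter := rev (map shadow s).

Lemma invwK : involutive invw.
Proof.
move=> s; rewrite /invw map_rev revK -map_comp map_id_in// => a _ /=.
exact: shadowK.
Qed.

Lemma invw_reduced s : reduced s -> reduced (invw s).
Proof.
rewrite /reduced /invw rev_sorted sorted_map; apply: sub_sorted => a b /=.
by rewrite shadowK eq_sym.
Qed.

Lemma reduce_invw s : reduce (invw s ++ s) = [::].
Proof.
elim: s => // a s; rewrite !reduce_cat /invw /= rev_cons -cats1 foldr_cat /=.
rewrite -{2}[a]shadowK pushK//; exact: reduce_reduced.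
Qed.

Definition vO : groupoid := exist _ [::] isT.

Definition mulO (u v : groupoid) : groupoid :=
  exist _ (reduce (val u ++ val v)) (reduce_reduced _).

Definition invO (u : groupoid) : groupoid :=
  exist _ (invw (val u)) (invw_reduced (valP u)).

Lemma mulOA : associative mulO.
Proof.
move=> u v w; apply: val_inj => /=; rewrite !(reduce_cat _ (reduce _)).
rewrite [in RHS]reduce_cat foldr_reduce ?reduce_reduced// foldr_cat.
rewrite (reduce_id (reduce_reduced _)) reduce_cat.
by rewrite (reduce_id (valP w)).
Qed.

Lemma mulvO : left_id vO mulO.
Proof. by move=> u; apply: val_inj; rewrite /= reduce_id// (valP u). Qed.

Lemma mulOv : right_id vO mulO.
Proof. by move=> u; apply: val_inj; rewrite /= cats0 reduce_id// (valP u). Qed.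

Lemma mulVO : left_inverse vO invO mulO.
Proof. by move=> u; apply: val_inj; exact: reduce_invw. Qed.

Lemma mulOV : right_inverse vO invO mulO.
Proof.
move=> u; apply: val_inj => /=.
by rewrite -{1}[val u]invwK reduce_invw.
Qed.

(* From here on [1%g] is v_O. *)
HB.instance Definition _ :=
  isGroup.Build groupoid mulOA mulvO mulOv mulVO mulOV.

End Groupoid.

Section Sums.
Variables (R : realType) (T : choiceType).

(* Sums over an arbitrary index set; the value is meaningful only for absolutely
   summable families. *)
Definition rsum (f : T -> R) : R :=
  fine (\esum_(i in [set: T]) (EFin \o f)^\+ i -
        \esum_(i in [set: T]) (EFin \o f)^\- i)%E.

Definition csum (f : T -> R[i]) : R[i] :=
  Complex (rsum (fun i => complex.Re (f i))) (rsum (fun i => complex.Im (f i))).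

Lemma rsum_ge0E (f : T -> R) : (forall i, 0 <= f i) ->
  rsum f = fine (\esum_(i in [set: T]) (f i)%:E)%E.
Proof.
move=> f0; rewrite /rsum [X in (_ - X)%E]esum1 ?sube0 => [|i _]; last first.
  by rewrite funenegE /= max_r// lee_fin oppr_le0.
by congr fine; apply: eq_esum => i _; rewrite funeposE /= max_l// lee_fin.
Qed.

Lemma rsum_reindex (e : T -> T) (f : T -> R) : bijective e ->
  rsum (f \o e) = rsum f.
Proof.
rewrite -setTT_bijective => be; rewrite /rsum; congr (fine (_ - _))%E;
  rewrite [RHS](reindex_esum [set: T] [set: T] e)//;
  by apply: eq_esum => i _; rewrite ?funeposE ?funenegE.
Qed.

Lemma rsum_supp1 (w : T) (f : T -> R) : (forall u, u != w -> f u = 0) ->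
  rsum f = f w.
Proof.
move=> f0.
have E (g : T -> \bar R) : (forall u, u != w -> g u = 0%E) -> (0 <= g w)%E ->
    \esum_(i in [set: T]) g i = g w.
  move=> g0 gw; have gge0 u : (0 <= g u)%E.
    by have [->//|/g0->] := eqVneq u w.
  rewrite (esumID [set w])// setTI esum_set1// esum1 ?adde0// => u [_ /eqP].
  exact: g0.
rewrite /rsum !E ?funeposE ?funenegE ?le_max ?lexx ?orbT// => [|u uw|u uw].
- rewrite /= -!EFin_max /=.
  have [fw|fw] := leP 0 (f w).
    by rewrite (max_r (x := - f w)) ?oppr_le0// subr0.
  by rewrite max_l ?oppr_ge0 1?ltW// sub0r opprK.
- by rewrite funenegE/= f0// oppr0 maxxx.
- by rewrite funeposE/= f0// maxxx.
Qed.

Lemma csum_reindex (e : T -> T) (f : T -> R[i]) : bijective e ->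
  csum (f \o e) = csum f.
Proof.
move=> be; congr Complex.
  exact: (rsum_reindex (fun i => complex.Re (f i)) be).
exact: (rsum_reindex (fun i => complex.Im (f i)) be).
Qed.

Lemma csum_supp1 (w : T) (f : T -> R[i]) : (forall u, u != w -> f u = 0) ->
  csum f = f w.
Proof.
move=> f0; rewrite /csum !(rsum_supp1 (w := w)) => [|u /f0->//|u /f0->//].
by case: (f w).
Qed.

End Sums.

Section L2.
Variables (R : realType) (n : nat).
Local Notation C := R[i].
Local Notation G := (groupoid n).

Definition square_summable (x : G -> C) : Prop :=
  summable [set: G] (fun w => (normc (x w) ^+ 2)%:E).

Definition l2_pred : {pred (G -> C)} := fun x => `[< square_summable x >].

Lemma square_summableP (x : G -> C) :
  square_summable x <-> exists M : R, forall A : set G, finite_set A ->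
    \sum_(w \in A) normc (x w) ^+ 2 <= M.
Proof.
have pos w : (0 <= (normc (x w) ^+ 2)%:E)%E by rewrite lee_fin sqr_ge0.
rewrite /square_summable /summable.
under eq_esum => w _ do rewrite gee0_abs//.
split.
- move=> h; exists (fine (\esum_(w in [set: G]) (normc (x w) ^+ 2)%:E)%E) => A fA.
  rewrite -lee_fin fineK; last first.
    by rewrite ge0_fin_numE// esum_ge0.
  apply: ereal_sup_ubound; exists A => //=.
  by rewrite fsumEFin.
- move=> [M hM]; apply: le_lt_trans (ltry M).
  apply: ge_ereal_sup => _ [A [fA _] <-].
  by rewrite fsumEFin// lee_fin hM.
Qed.

Lemma normcD2 (z t : C) :
  normc (z + t) ^+ 2 <= 2 * normc z ^+ 2 + 2 * normc t ^+ 2.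
Proof.
case: z t => a b [c d] /=.
rewrite !sqr_sqrtr ?addr_ge0 ?sqr_ge0// -subr_ge0.
rewrite [leRHS](_ : _ = (a - c) ^+ 2 + (b - d) ^+ 2); last by ring.
by rewrite addr_ge0 ?sqr_ge0.
Qed.

Lemma l2_submod_closed : submod_closed l2_pred.
Proof.
split=> [|a x y /asboolP/square_summableP[M hM] /asboolP/square_summableP[N hN]].
  apply/asboolP/square_summableP; exists 0 => A fA; rewrite fsbig1// => w _.
  by rewrite normc0 expr0n.
apply/asboolP/square_summableP.
exists (2 * (normc a ^+ 2 * M) + 2 * N) => A fA.
have fE f : \sum_(w \in A) f w = \sum_(w <- finmap.enum_fset (fset_set A)) f w :> R.
  by rewrite fsbig_finite.
apply: (@le_trans _ _ (\sum_(w \in A)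
    (2 * (normc a ^+ 2 * normc (x w) ^+ 2) + 2 * normc (y w) ^+ 2))).
  rewrite !fE; apply: ler_sum => w _.
  by rewrite -exprMn -normcM; exact: normcD2.
move: (hM A fA) (hN A fA); rewrite !fE => hM' hN'.
rewrite big_split /= -!mulr_sumr lerD// ler_pM2l// ler_wpM2l//.
exact: sqr_ge0.
Qed.

HB.instance Definition _ :=
  GRing.isSubmodClosed.Build C (G -> C) l2_pred l2_submod_closed.

Definition l2 : Type := {x : G -> C | x \in l2_pred}.
HB.instance Definition _ := Choice.on l2.
HB.instance Definition _ := SubType.on l2.
HB.instance Definition _ := [SubChoice_isSubLmodule of l2 by <:].

Lemma l2P (x : l2) : square_summable (val x).
Proof. exact/asboolP/(valP x). Qed.

(* Linear in the first variable. *)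
Definition inner (x y : l2) : C := csum (fun w => val x w * (val y w)^* ).

Definition l2norm (x : l2) : R := Num.sqrt (complex.Re (inner x x)).

Record bop := Bop {
  bop_fun :> {linear l2 -> l2};
  bop_bounded : exists M : R, forall x, l2norm (bop_fun x) <= M * l2norm x }.

Lemma l2_xi (w : G) : (fun u => (u == w)%:R : C) \in l2_pred.
Proof.
apply/asboolP/square_summableP; exists 1 => A fA.
have [Aw|Aw] := pselect (A w); last first.
  rewrite fsbig1// => u Au; case: eqP => [uw|_]; first by rewrite uw in Au.
  by rewrite normc0 expr0n.
rewrite (fsbigD1 w)//= eqxx normc1 expr1n fsbig1 ?addr0// => u [_ /eqP/negPf ->].
by rewrite normc0 expr0n.
Qed.

Definition xi (w : G) : l2 :=
  exist (fun x => x \in l2_pred) _ (l2_xi w).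

Lemma bij_mulg (w : G) : bijective (fun u : G => (w * u)%g).
Proof. by exists (fun u => (w^-1 * u)%g) => u; rewrite ?mulKg ?mulVKg. Qed.

Lemma l2_Lop (w : G) (x : l2) : (fun u => val x (w^-1 * u)%g) \in l2_pred.
Proof.
apply/asboolP; have := l2P x; rewrite /square_summable /summable.
rewrite (reindex_esum [set: G] [set: G] (fun u => w^-1 * u)%g)//.
by rewrite setTT_bijective; exact: bij_mulg.
Qed.

(* The bounded extension of xi_u |-> xi_(w * u), see [Lop_xi]. *)
Definition Lfun (w : G) (x : l2) : l2 :=
  exist (fun x => x \in l2_pred) _ (l2_Lop w x).

Lemma Lfun_linear w : linear (Lfun w).
Proof. by move=> a x y; apply/val_inj. Qed.

HB.instance Definition _ w :=
  GRing.isLinear.Build C l2 l2 *:%R (Lfun w) (Lfun_linear w).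

Lemma Lfun_bounded w : exists M : R, forall x, l2norm (Lfun w x) <= M * l2norm x.
Proof.
exists 1 => x; rewrite mul1r /l2norm /inner.
rewrite -[in leRHS](csum_reindex _ (bij_mulg w^-1%g)).
exact: lexx.
Qed.

Definition Lop (w : G) : bop := Bop (Lfun_bounded w).

Lemma Lop_xi w u : Lop w (xi u) = xi (w * u)%g.
Proof.
apply/val_inj/funext => v /=; congr (_%:R); congr nat_of_bool.
by apply/eqP/eqP => [<-|->]; rewrite ?mulKg ?mulVKg.
Qed.

Definition span_L : set bop :=
  [set A : bop | exists (s : seq G) (a : G -> C),
    forall x, A x = \sum_(w <- s) a w *: Lop w x].

(* The sets of A satisfying the inner condition are the basic neighbourhoods of T
   for the weak operator topology. *)
Definition wot_closure (S : set bop) : set bop :=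
  [set T : bop | forall (m : nat) (x y : 'I_m -> l2) (e : R), 0 < e ->
    exists2 A, S A &
      forall i, normc (inner (T (x i)) (y i) - inner (A (x i)) (y i)) < e].

Definition graph_vna : set bop := wot_closure span_L.

(* For T in the von Neumann algebra this is the coefficient t_w of L_w in the
   expansion of T, see [expansion_xi] and [graph_operatorE]. *)
Definition coef (T : bop) (w : G) : C := inner (T (xi 1%g)) (xi w).

Definition supp (T : bop) : set G := [set w | coef T w != 0].

Definition graph_operator (T : bop) : Prop := graph_vna T /\ finite_set (supp T).

Definition adjoint (T S : bop) : Prop :=
  forall x y, inner (T x) y = inner x (S y).

Definition unitary (T : bop) : Prop :=
  exists S : bop, [/\ adjoint T S, forall x, S (T x) = x & forall x, T (S x) = x].

Lemma inner_xi (x : l2) w : inner x (xi w) = val x w.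
Proof.
rewrite /inner (csum_supp1 (w := w)) => [|u /negPf uw] /=.
  by rewrite eqxx conjC1 mulr1.
by rewrite uw conjC0 mulr0.
Qed.

Lemma l2_sumE (I : Type) (s : seq I) (a : I -> C) (y : I -> l2) v :
  val (\sum_(i <- s) a i *: y i) v = \sum_(i <- s) a i * val (y i) v.
Proof.
elim: s => [|i s IHs]; first by rewrite !big_nil.
by rewrite !big_cons -IHs.
Qed.

Lemma xiM (w u v : G) : val (xi (w * u)%g) v = val (xi w) (v * u^-1)%g.
Proof.
rewrite /=; congr (_%:R); congr nat_of_bool.
by apply/eqP/eqP => [->|<-]; rewrite ?mulgK ?mulgVK.
Qed.

Lemma normc_ge0 (z : C) : 0 <= normc z.
Proof. by case: z => a b; exact: sqrtr_ge0. Qed.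

(* T xi_u is the sum of the t_w L_w xi_u = t_w xi_(w * u). *)
Lemma expansion_xi (T : bop) : graph_vna T ->
  forall u v, val (T (xi u)) v = coef T (v * u^-1)%g.
Proof.
move=> MT u v; apply/eqP; rewrite -subr_eq0; apply/eqP/eq0_normc/eqP.
rewrite eq_le normc_ge0 andbT; apply/ler_addgt0Pr => e e0; rewrite add0r.
pose x (i : 'I_2) := if i == 0 then xi u else xi 1%g.
pose y (i : 'I_2) := if i == 0 then xi v else xi (v * u^-1)%g.
have e20 : 0 < e / 2 by rewrite divr_gt0.
have [A [s [a sA]] hA] := MT 2%N x y (e / 2) e20.
have : normc (inner (T (xi u)) (xi v) - inner (A (xi u)) (xi v)) < e / 2.
  exact: (hA ord0).
have : normc (inner (T (xi 1%g)) (xi (v * u^-1)%g) -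
              inner (A (xi 1%g)) (xi (v * u^-1)%g)) < e / 2 := hA (lift ord0 ord0).
rewrite /coef !inner_xi.
have -> : val (A (xi u)) v = val (A (xi 1%g)) (v * u^-1)%g.
  rewrite !sA !l2_sumE; apply: eq_bigr => w _.
  by rewrite !Lop_xi xiM mulg1.
set c1 := val (T (xi u)) v; set c2 := val (T (xi 1%g)) _; set c := val _ _.
move=> h2 h1; have -> : c1 - c2 = (c1 - c) - (c2 - c) by ring.
by rewrite (le_trans (le_normcD _ _))// normcN [e]splitr lerD// ltW.
Qed.

Lemma l2norm_ge0 (x : l2) : 0 <= l2norm x.
Proof. exact: sqrtr_ge0. Qed.

Lemma normc_sqr (z : C) : complex.Re (z * z^* ) = normc z ^+ 2.
Proof.
case: z => a b /=; rewrite sqr_sqrtr ?addr_ge0 ?sqr_ge0//.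
by rewrite mulrN opprK.
Qed.

Lemma l2normE (x : l2) :
  (l2norm x ^+ 2)%:E = (\esum_(w in [set: G]) (normc (val x w) ^+ 2)%:E)%E.
Proof.
rewrite /l2norm /inner /=.
under eq_fun do rewrite normc_sqr.
rewrite rsum_ge0E => [|w]; last exact: sqr_ge0.
have pos : (0 <= \esum_(w in [set: G]) (normc (val x w) ^+ 2)%:E)%E.
  by apply: esum_ge0 => w _; rewrite lee_fin sqr_ge0.
rewrite sqr_sqrtr ?fine_ge0// fineK// ge0_fin_numE//.
have := l2P x; rewrite /square_summable /summable.
by under eq_esum => w _ do rewrite gee0_abs ?lee_fin ?sqr_ge0//.
Qed.

Lemma normc_le_l2norm (x : l2) w : normc (val x w) <= l2norm x.
Proof.
rewrite -ler_sqr ?nnegrE ?normc_ge0 ?l2norm_ge0// -lee_fin l2normE.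
apply: ereal_sup_ubound; exists [set w]; first by split.
by rewrite fsbig_set1.
Qed.

(* Finitely supported vectors are dense. *)
Lemma l2_approx (x : l2) (e : R) : 0 < e -> exists (s : seq G),
  l2norm (x - \sum_(w <- s) val x w *: xi w) < e.
Proof.
move=> e0; have E := l2normE x; set F := fun w => (normc (val x w) ^+ 2)%:E in E.
have F0 w : (0 <= F w)%E by rewrite lee_fin sqr_ge0.
have e20 : 0 < e ^+ 2 by rewrite exprn_gt0.
have fE : (ereal_sup [set (\sum_(w \in A) F w)%E | A in fsets [set: G]])
    \is a fin_num by rewrite -/(esum _ F) -E.
have [_ [A [fA _] <-] hA] := ub_ereal_sup_adherent e20 fE.
rewrite -/(esum _ F) in hA.
pose s := finmap.enum_fset (fset_set A).
have us : uniq s by exact: finmap.fset_uniq.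
have sA w : (w \in s) = (w \in A) by rewrite /s in_fset_set.
exists s; set y := x - _.
have yE w : val y w = if w \in A then 0 else val x w.
  have -> : val y w = val x w - \sum_(u <- s) val x u * val (xi u) w.
    by rewrite -l2_sumE.
  case: ifPn => wA.
    rewrite (bigD1_seq w) ?sA//= eqxx mulr1 big1 ?addr0 ?subrr// => u /negPf uw.
    by rewrite eq_sym uw mulr0.
  rewrite big_seq big1 ?subr0// => u; rewrite sA => uA /=.
  case: eqP => [wu|_]; last by rewrite mulr0.
  by rewrite wu uA in wA.
rewrite -ltr_sqr ?nnegrE ?l2norm_ge0 ?ltW// -lte_fin l2normE.
rewrite (esumID A) ?setTI; last by move=> w _; rewrite lee_fin sqr_ge0.
rewrite esum1 ?add0e => [|w /mem_set wA]; last by rewrite yE wA normc0 expr0n.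
rewrite (_ : esum _ _ = \esum_(w in ~` A) F w); last first.
  by apply: eq_esum => w wA; rewrite yE memNset.
have : (\sum_(w \in A) F w + \esum_(w in ~` A) F w = (l2norm x ^+ 2)%:E)%E.
  by rewrite E (esumID A [set: G]) ?setTI ?[esum A _]esum_fset// => w _; exact: F0.
move: hA; rewrite -E {1}/F fsumEFin//.
set b := \sum_(w \in A) _; have := esum_ge0 (fun w (_ : (~` A) w) => F0 w).
case: (\esum_(w in ~` A) F w) => [r| |]//=.
rewrite -EFinB -EFinD !lte_fin => _ h [h']; lra.
Qed.

Lemma graph_operatorE (T : bop) : graph_operator T ->
  forall x, T x = \sum_(w \in supp T) coef T w *: Lop w x.
Proof.
move=> [MT fS] x; rewrite fsbig_finite//=; set s := finmap.enum_fset _.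
pose D x := T x - \sum_(w <- s) coef T w *: Lop w x.
have DP a y z : D (a *: y + z) = a *: D y + D z.
  rewrite /D linearP /= scalerBr addrACA -opprD; congr (_ - _).
  rewrite scaler_sumr -big_split/=; apply: eq_bigr => w _.
  by rewrite linearP /= scalerDr !scalerA [a * _]mulrC.
have DB y z : D (y - z) = D y - D z by rewrite addrC -scaleN1r DP scaleN1r addrC.
have us : uniq s by exact: finmap.fset_uniq.
have Dxi u : D (xi u) = 0.
  apply/val_inj/funext => v.
  have -> : val (D (xi u)) v =
      val (T (xi u)) v - \sum_(w <- s) coef T w * val (Lop w (xi u)) v.
    by rewrite -l2_sumE.
  rewrite expansion_xi//; apply/eqP; rewrite subr_eq0; apply/eqP.
  under eq_bigr do rewrite Lop_xi xiM.
  have [vs|vs] := boolP ((v * u^-1)%g \in s).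
    rewrite (bigD1_seq _ vs us) /= eqxx mulr1 big1 ?addr0// => w /negPf wv.
    by rewrite eq_sym wv mulr0.
  have /eqP c0 : coef T (v * u^-1)%g == 0.
    apply/negPn/negP => /= vu; move/negP: vs; apply.
    by rewrite in_fset_set// inE.
  rewrite c0 big1// => w _ /=; case: eqP => [<-|_]; last by rewrite mulr0.
  by rewrite c0 mul0r.
have D0 r : D (\sum_(w <- r) val x w *: xi w) = 0.
  elim: r => [|w r IHr]; last by rewrite big_cons DP IHr Dxi scaler0 addr0.
  by have := DB 0 0; rewrite big_nil subr0 subrr.
have [M TM] := bop_bounded T.
pose K := M + \sum_(w <- s) normc (coef T w).
have DK y v : normc (val (D y) v) <= K * l2norm y.
  have -> : val (D y) v = val (T y) v - \sum_(w <- s) coef T w * val (Lop w y) v.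
    by rewrite -l2_sumE.
  rewrite (le_trans (le_normcD _ _))// normcN /K mulrDl lerD//.
    exact: le_trans (normc_le_l2norm _ _) (TM _).
  rewrite mulr_suml; elim: (s) => [|w r IHr]; first by rewrite !big_nil normc0.
  rewrite !big_cons (le_trans (le_normcD _ _))// lerD// normcM.
  by rewrite ler_wpM2l ?normc_ge0//=; exact: normc_le_l2norm.
apply/eqP; rewrite -subr_eq0 -/(D x); apply/eqP/val_inj/funext => v.
apply: eq0_normc; apply/eqP; rewrite eq_le normc_ge0 andbT.
apply/ler_addgt0Pr => e e0; rewrite add0r.
have K0 : 0 < `|K| + 1 by rewrite ltr_wpDl.
have [r hr] := l2_approx x (divr_gt0 e0 K0).
rewrite -[D x]subr0 -(D0 r) -DB (le_trans (DK _ _))//.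
rewrite (@le_trans _ _ ((`|K| + 1) * (e / (`|K| + 1))))//; last first.
  by rewrite mulrC divfK// gt_eqF.
rewrite (@le_trans _ _ (`|K| * (e / (`|K| + 1))))//.
  rewrite (@le_trans _ _ (`|K| * l2norm (x - \sum_(w <- r) val x w *: xi w)))//.
    by rewrite ler_wpM2r ?l2norm_ge0// ler_norm.
  by rewrite ler_wpM2l// ltW.
by rewrite ler_wpM2r ?divr_ge0// ?ltW// ltrDl.
Qed.

End L2.

(* Main.v *)
(* If T is unitary, then <T xi_g, T xi_1> = 0 for every g <> 1; the left-hand side
   is the sum of t_{w1} (t_{w2})^* over the pairs in Supp(T) with w1^-1 w2 = g.
   Choose such a pair with w1^-1 w2 of maximal length.  Any other pair with the same
   quotient g would give k <> 1 with k g and k^-1 g both quotients of elements of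
   the support, hence neither longer than g, which is impossible in a free group.
   So the sum has a single nonzero term, forcing g = 1: the support is a singleton,
   and the rest is the computation of (t L_w)^* (t L_w). *)
Require Import Defs.
From mathcomp Require Import all_boot all_order all_algebra.
From mathcomp Require Import complex zify.
From mathcomp Require Import all_classical all_reals all_analysis.

Set Implicit Arguments.
Unset Strict Implicit.
Unset Printing Implicit Defensive.

Import Order.TTheory GRing.Theory Num.Theory.

Local Open Scope classical_set_scope.
Local Open Scope ring_scope.

Lemma seq_argmax (I : eqType) (F : I -> nat) (s : seq I) : s != [::] ->
  exists2 x, x \in s & forall y, y \in s -> (F y <= F x)%N.
Proof.
elim: s => // a [|b s] IHs _.
  by exists a => [|y]; rewrite ?mem_head// inE => /eqP ->.
have [//|x xs xmax] := IHs.
have [le_xa|lt_ax] := leqP (F x) (F a).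
  exists a => [|y]; rewrite ?mem_head// inE => /predU1P[->//|/xmax].
  by move/leq_trans; apply.
exists x => [|y]; first by rewrite inE xs orbT.
by rewrite inE => /predU1P[->|/xmax//]; exact: ltnW.
Qed.

Section FreeGroup.
Variable n : nat.
Implicit Types (a : letter n) (s t : seq (letter n)) (g h : groupoid n).

Lemma size_invw s : size (invw s) = size s.
Proof. by rewrite size_rev size_map. Qed.

Lemma invw_cat s t : invw (s ++ t) = invw t ++ invw s.
Proof. by rewrite /invw map_cat rev_cat. Qed.

Lemma shadow_neq a : shadow a != a.
Proof. by case: a => i []; rewrite /shadow xpair_eqE eqxx. Qed.

(** A suffix of [s] cancels against the start of [t]. Once a letter of [s] survives, reducedness of
    [s] protects every letter pushed after it. *)
Lemma foldr_push_cancel s t : reduced s ->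
  exists s1 s2 t', [/\ s = s1 ++ s2, t = invw s2 ++ t' &
    foldr (@push n) t s = s1 ++ t'].
Proof.
elim: s => [_|a s IHs ras]; first by exists [::], [::], t.
have [s1 [s2 [t' [Es Et /= ->]]]] := IHs (path_sorted ras).
case: s1 Es => [|b s1] Es.
  case: t' Et => [|b t'] Et /=.
    by exists [:: a], s2, [::]; rewrite Es.
  case: eqP => [Eb|_]; last by exists [:: a], s2, (b :: t'); rewrite Es.
  exists [::], (a :: s2), t'; split; rewrite ?Es//.
  by rewrite Et Eb /invw /= rev_cons cat_rcons.
exists (a :: b :: s1), s2, t'; rewrite Es; split => //=.
by move: ras; rewrite Es /= => /andP[/negPf->].
Qed.

(* If neither h nor its inverse lengthens g, both share their first half with g,
   so the middle of h is a factor [a (shadow a)] or a self-inverse letter. *)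
Lemma mulg_lengthens g h : h != 1%g ->
  (size (val g) < size (val (h * g)%g))%N ||
  (size (val g) < size (val (h^-1 * g)%g))%N.
Proof.
apply: contraNT; rewrite negb_or -!leqNgt => /andP[].
set s := val h; set t := val g.
have rs : reduced s := valP h.
have hE x : val (x * g)%g = foldr (@push n) t (val x).
  by rewrite /= reduce_cat (reduce_id (valP g)).
rewrite !hE -/s (_ : val h^-1%g = invw s)//.
have [s1 [s2 [t1 [Es Et1 ->]]]] := foldr_push_cancel t rs.
have [r1 [r2 [t2 [Er Et2 ->]]]] := foldr_push_cancel t (invw_reduced rs).
(* Neither product is longer than [t], so at least half of [s] and at least half of [invw s]
   cancel. *)
rewrite {1}Et1 {1}Et2 !size_cat !leq_add2r !size_invw => le_s le_r.
have szE : size s = (size r1 + size r2)%N by rewrite -size_invw Er size_cat.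
have szE' : size s = (size s1 + size s2)%N by rewrite Es size_cat.
have Es' : s = invw r2 ++ invw r1 by rewrite -[s]invwK Er invw_cat.
have Ei : invw s = invw s2 ++ invw s1 by rewrite Es invw_cat.
(* Both [invw s2] and [invw r2] are prefixes of [t]; they are also prefixes of [invw s] and [s], so
   these two words agree up to and including any middle letter. *)
have half i : (i.*2 < size s)%N -> forall a0,
    nth a0 s i = shadow (nth a0 s (size s - i.+1)).
  move=> i_s a0; have i_s2 : (i < size s2)%N by lia.
  have i_r2 : (i < size r2)%N by lia.
  have := congr1 (fun u => nth a0 u i) Et2; rewrite {1}Et1 !nth_cat !size_invw.
  rewrite i_s2 i_r2 => E.
  have -> : nth a0 s i = nth a0 (invw r2) i by rewrite Es' nth_cat size_invw i_r2.
  have <- : nth a0 (invw s) i = shadow (nth a0 s (size s - i.+1)).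
    by rewrite /invw nth_rev ?size_map ?(nth_map a0)//; lia.
  by rewrite -E Ei nth_cat size_invw i_s2.
have [s0|s0] := eqVneq s [::]; first by apply/eqP/val_inj.
have [a0 _] : exists a0 : letter n, true by case: (s) s0 => // a0; exists a0.
(* The last index of the first half: its mirror image is the next position if the length is even,
   and itself if the length is odd. *)
have := half (size s).-1./2; case Em: (size s) => [|m]; first by case: (s) s0 Em.
move=> /= /(_ _ a0); have dm := odd_double_half m.
case: (boolP (odd m)) dm => om dm.
  rewrite (_ : m.+1 - _ = m./2.+1)%N; last by lia.
  have /(sortedP a0)/(_ m./2) := rs; rewrite Em => /(_ _)/eqP nE E.
  by case: nE; rewrite ?E ?shadowK//; lia.
rewrite (_ : m.+1 - _ = m./2)%N; last by lia.
by move=> E; have := shadow_neq (nth a0 s m./2); rewrite -E ?eqxx//; lia.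
Qed.

End FreeGroup.

Section Operators.
Variables (R : realType) (n : nat).
Implicit Types (T : bop R n) (x y : l2 R n) (w : groupoid n).

Lemma inner_xi_xi u v : inner (xi R u) (xi R v) = (v == u :> groupoid n)%:R.
Proof. by rewrite inner_xi. Qed.

Lemma unitary_inner T x y : unitary T -> inner (T x) (T y) = inner x y.
Proof. by move=> [S [adj ST _]]; rewrite adj ST. Qed.

(** Since [v * u^-1] and [v] have quotient [u], the nonzero terms correspond to the pairs in the
    support with that quotient. *)
Lemma inner_coef T u : graph_vna T ->
  inner (T (xi R u)) (T (xi R 1%g)) =
  csum (fun v => coef T (v * u^-1)%g * (coef T v)^*).
Proof.
move=> MT; congr csum; apply/funext => v.
by rewrite !expansion_xi// invg1 mulg1.
Qed.

Lemma unitary_supp T : graph_operator T -> unitary T -> exists w, supp T = [set w].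
Proof.
move=> [MT fS] uT.
(* With empty support, [T] would send the unit vector at 1 to a vector of norm 0. *)
have [w0 Sw0] : supp T !=set0.
  apply/set0P/negP => /eqP S0.
  have c0 w : coef T w = 0.
    by apply/eqP/negPn/negP => /= cw; have : supp T w by []; rewrite S0.
  have := unitary_inner (xi R 1%g) (xi R 1%g) uT.
  rewrite inner_coef// (@csum_supp1 _ _ 1%g) => [|u _]; last by rewrite c0 mul0r.
  by rewrite inner_xi_xi eqxx c0 mul0r => /esym/eqP; rewrite oner_eq0.
pose s := finmap.enum_fset (fset_set (supp T)).
have sE w : (w \in s) = (w \in supp T) by rewrite /s in_fset_set.
have s_prod w1 w2 : ((w1, w2) \in [seq (u, v) | u <- s, v <- s]) =
    (w1 \in supp T) && (w2 \in supp T).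
  rewrite -!sE; apply/allpairsP/andP => [[[u v] /= [su sv [-> ->]]]|[su sv]] //.
  by exists (w1, w2).
pose len (p : groupoid n * groupoid n) := size (val (p.1^-1 * p.2)%g).
have [|[w1 w2]] := @seq_argmax _ len [seq (u, v) | u <- s, v <- s].
  by apply/eqP => E; have := s_prod w0 w0; rewrite E mem_set.
rewrite s_prod => /andP[/set_mem S1 /set_mem S2] wmax.
pose g := (w1^-1 * w2)%g.
have g1 : g = 1%g.
  apply/eqP/negPn/negP => g1.
  have := unitary_inner (xi R g) (xi R 1%g) uT.
  rewrite inner_coef// (@csum_supp1 _ _ w2) => [|v vw2].
    rewrite inner_xi_xi eq_sym (negPf g1) invgM invgK mulVKg => /eqP.
    by rewrite mulf_eq0 conjC_eq0 (negPf S1) (negPf S2).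
  apply/eqP; rewrite mulf_eq0 conjC_eq0; apply/negPn/negP.
  rewrite negb_or => /andP[Sv' Sv].
  (* A second pair [(v * g^-1, v)] with quotient [g] yields two cross quotients with [(w1, w2)],
     namely [k * g] and [k^-1 * g]; one of them would be longer than [g]. *)
  pose k := (w1^-1 * (v * g^-1))%g.
  have k1 : k != 1%g.
    apply: contra vw2 => /eqP /(canRL (mulVKg _)); rewrite mulg1.
    by move/(canRL (mulgVK _)) => ->; rewrite mulVKg.
  have kg : (k * g)%g = (w1^-1 * v)%g by rewrite /k -!mulgA mulVg mulg1.
  have kVg : (k^-1 * g)%g = ((v * g^-1)^-1 * w2)%g.
    by rewrite /k invgM invgK -mulgA mulVKg.
  have := mulg_lengthens g k1; rewrite kg kVg !ltnNge -negb_and => /negP; apply.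
  by rewrite (wmax (w1, v)) ?(wmax ((v * g^-1)%g, w2)) ?s_prod ?mem_set.
exists w1; apply/seteqP; split=> [w Sw|_ ->//].
(* The maximal length is now 0, so every quotient is the empty word. *)
have : (size (val (w1^-1 * w)%g) <= size (val g))%N.
  by apply: (wmax (w1, w)); rewrite s_prod !mem_set.
rewrite g1 -[X in (_ <= X)%N]/0%N leqn0 size_eq0 => /eqP E.
have : (w1^-1 * w)%g = 1%g by apply: val_inj.
by move/(canRL (mulVKg _)); rewrite mulg1.
Qed.

(** Left translation by [w] permutes the index set, so reindexing moves the shift to the second
    argument. *)
Lemma inner_scale_Lop (c : R[i]) w x y :
  inner (c *: Lop R w x) y = inner x (c^* *: Lop R w^-1%g y).
Proof.
rewrite /inner -[LHS](csum_reindex _ (bij_mulg w)).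
congr csum; apply/funext => v /=.
by rewrite !scalrfctE mulKg invgK rmorphM /= conjCK mulrCA mulrA.
Qed.

Lemma scale_LopK (c d : R[i]) w x : d * c = 1 ->
  d *: Lop R w^-1%g (c *: Lop R w x) = x.
Proof.
move=> dc1; rewrite linearZ scalerA dc1 scale1r.
by apply/val_inj/funext => v /=; rewrite invgK mulKg.
Qed.

Lemma unitary_scale_Lop w (t : R[i]) T : t^* * t = 1 ->
  (forall x, T x = t *: Lop R w x) -> unitary T.
Proof.
move=> t1 TE.
have bnd : exists M : R, forall x,
    l2norm ((t^* \*: Lop R w^-1%g) x) <= M * l2norm x.
  (* The candidate inverse is an isometry, because its own adjoint [t *: Lop w] undoes it. *)
  exists 1 => x; rewrite mul1r /l2norm inner_scale_Lop conjCK.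
  by rewrite scale_LopK // mulrC.
exists (Bop bnd); split=> [x y|x|x]; rewrite ?TE ?inner_scale_Lop//=.
  exact: scale_LopK.
by rewrite -{1}[w]invgK scale_LopK // mulrC.
Qed.

End Operators.

Theorem theorem3p3 (R : realType) (n : nat) (T : bop R n) (hT : graph_operator T) :
  unitary T <->
  [set (w1^-1 * w2)%g | w1 in supp T & w2 in supp T] = [set vO n] /\
  \sum_(p \in supp T `*` supp T) (coef T p.1)^* * coef T p.2 = 1.
Proof.
have sum1 w : supp T = [set w] ->
    \sum_(p \in supp T `*` supp T) (coef T p.1)^* * coef T p.2 =
    (coef T w)^* * coef T w.
  move=> ->; rewrite (_ : _ `*` _ = [set (w, w)]) ?fsbig_set1//.
  by apply/seteqP; split=> [[u v] /= [-> ->]|_ ->].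
split=> [uT|[quot tt]].
  have [w Sw] := unitary_supp hT uT; split.
    rewrite Sw; apply/seteqP; split=> [_ [_ -> [_ -> <-]]|_ ->] /=.
      by rewrite mulVg.
    by exists w => //; exists w => //; rewrite mulVg.
  (* The squared norm of [T (xi 1)] is 1, and only the index [w] contributes to it. *)
  have := unitary_inner (xi R 1%g) (xi R 1%g) uT.
  rewrite (sum1 w Sw) (inner_coef _ hT.1) (@csum_supp1 _ _ w) => [|v vw].
    by rewrite invg1 mulg1 inner_xi_xi eqxx mulrC.
  suff -> : coef T v = 0 by rewrite conjC0 mulr0.
  apply/eqP/negPn/negP => cv; have : supp T v by [].
  by rewrite Sw => /eqP; rewrite (negPf vw).
have [w Sw] : exists w, supp T = [set w].
  (* That [vO] occurs as a quotient makes the support nonempty. *)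
  have [w Sw _] : [set (w1^-1 * w2)%g | w1 in supp T & w2 in supp T] (vO n).
    by rewrite quot.
  exists w; apply/seteqP; split=> [v Sv|_ ->//] /=.
  have : [set (w1^-1 * w2)%g | w1 in supp T & w2 in supp T] (w^-1 * v)%g.
    by exists w => //; exists v.
  by rewrite quot => /(canRL (mulVKg _)) ->; exact: mulg1.
rewrite (sum1 w Sw) in tt.
by apply: unitary_scale_Lop tt _ => x; rewrite graph_operatorE// Sw fsbig_set1.
Qed.
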